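(* Let $k$ be a nonnegative integer, and let $G$ be a $(k+1)$-connected graph of order $n$ with $n\equiv k \pmod 2$. Let $\theta(n,k)$ denote the largest root of the equation $$x^{3}-(n-4)x^{2}-(n+2k-1)x+2(k+1)(n-k-4)=0.$$ Then the following hold. (i) Suppose that either $n\geq k+4$ and $n\notin\{k+6,k+8\}$, or $(k,n)=(0,8)$. If $\rho(G)>\theta(n,k)$, then $G$ is $k$-factor-critical. (ii) Suppose that $n=k+6$. If $\rho(G)>\frac{k+1+\sqrt{k^{2}+18k+33}}{2}$, then $G$ is $k$-factor-critical. (iii) Suppose that $k\geq 1$ and $n=k+8$. If $\rho(G)>\frac{k+2+\sqrt{k^{2}+24k+64}}{2}$, then $G$ is $k$-factor-critical.
   Context: All graphs are finite and simple (no loops, no multiple edges). The order of a graph $G$ is $|V(G)|$. The spectral radius $\rho(G)$ is the largest eigenvalue of the (0,1)-adjacency matrix $A(G)$ of $G$. For $Q\subseteq V(G)$, $G-Q$ is the graph obtained from $G$ by removing the vertices in $Q$ and their incident edges. A perfect matching (1-factor) of a graph is a spanning subgraph in which every vertex has degree exactly 1. For a nonnegative integer $k$, a graph $G$ is $k$-factor-critical if $G-Q$ has a perfect matching for every $Q\subseteq V(G)$ with $|Q|=k$. *)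

(* Defs.v *)
From mathcomp Require Import all_boot all_order all_algebra.
From mathcomp Require Import reals.

Set Implicit Arguments.
Unset Strict Implicit.
Unset Printing Implicit Defensive.

Import Order.TTheory GRing.Theory Num.Theory.
Local Open Scope ring_scope.

(* A finite simple graph is a symmetric irreflexive relation [e : rel T] on a
   [T : finType]. *)

(* [G - Q], as a graph on the subtype of the remaining vertices. *)
Definition del_vertices (T : finType) (e : rel T) (Q : {set T}) :
    rel {x : T | x \notin Q} :=
  fun x y => e (val x) (val y).

Definition connected_graph (T : finType) (e : rel T) : Prop :=
  forall x y : T, connect e x y.

(* The bound on the order gives complete graphs their usual connectivity: the
   complete graph of order [m.+1] is m-connected but not (m+1)-connected. *)
Definition vertex_connected (m : nat) (T : finType) (e : rel T) : Prop :=
  (m < #|T|)%N /\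
  forall X : {set T}, (#|X| < m)%N -> connected_graph (@del_vertices T e X).

Definition has_perfect_matching (T : finType) (e : rel T) : Prop :=
  exists m : rel T,
    [/\ symmetric m, subrel m e & forall x : T, #|[set y | m x y]| = 1%N].

Definition factor_critical (k : nat) (T : finType) (e : rel T) : Prop :=
  forall Q : {set T}, #|Q| = k -> has_perfect_matching (@del_vertices T e Q).

Definition adjacency_mx (R : realType) (T : finType) (e : rel T) : 'M[R]_#|T| :=
  \matrix_(i, j) (e (enum_val i) (enum_val j))%:R.

Definition is_largest (R : realType) (P : R -> Prop) (x : R) : Prop :=
  P x /\ forall y : R, P y -> y <= x.

Definition is_spectral_radius (R : realType) (T : finType) (e : rel T)
    (rho : R) : Prop :=
  is_largest (fun x => eigenvalue (adjacency_mx R e) x) rho.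

Definition theta_equation (R : realType) (n k : nat) (x : R) : Prop :=
  x ^+ 3 - (n%:R - 4) * x ^+ 2 - (n%:R + 2 * k%:R - 1) * x
    + 2 * (k%:R + 1) * (n%:R - k%:R - 4) = 0.

Definition is_theta (R : realType) (n k : nat) (theta : R) : Prop :=
  is_largest (theta_equation n k) theta.

(* Main.v *)
Require Import Defs.
From mathcomp Require Import all_boot all_order all_algebra.
From mathcomp Require Import reals zify ring lra.

Set Implicit Arguments.
Unset Strict Implicit.
Unset Printing Implicit Defensive.

(* If [G - Q] has no perfect matching for some [Q] of size [k], Tutte's theorem
   and connectivity give a set [X] of size [x = k + 1 + j] such that [G - X]
   splits into [x - k + 2] parts without edges between them. A positive vector
   [y] with [A y <= lam y] bounds the spectral radius by [lam]; taking [y]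
   constant on [X] and on each part, and using convexity in the sizes of the
   parts, one compares [G] with the join of K_x with one clique and isolated
   vertices. The resulting condition on [lam] is bounded below by the linear
   interpolation of its values at the two extreme values of [j]: the case
   [j = 0] is the cubic defining [theta], and the other extreme, where the clique
   is a single vertex, is the quadratic of cases (ii) and (iii). *)

(** * Tutte's theorem *)

(** A perfect matching of the subgraph induced on [A], stored as the map to the partner. Ranging
    over [{ffun T -> T}] makes it a boolean, so that a matchable set of maximum size can be
    chosen. *)
Definition matchable (T : finType) (e : rel T) (A : {set T}) : bool :=
  [exists f : {ffun T -> T}, [forall x in A,
    [&& f x \in A, f (f x) == x & e x (f x)]]].

Lemma matchableP (T : finType) (e : rel T) (A : {set T}) :
  reflect (exists f : T -> T, forall x, x \in A ->
             [/\ f x \in A, f (f x) = x & e x (f x)])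
          (matchable e A).
Proof.
apply: (iffP existsP) => [[f /forall_inP fP]|[f fP]].
  by exists f => x /fP /and3P[? /eqP ? ?].
exists (finfun f); apply/forall_inP => x /fP [fA ff ef].
by rewrite !ffunE fA ff eqxx.
Qed.

Lemma matchable0 (T : finType) (e : rel T) : matchable e set0.
Proof. by apply/matchableP; exists id => x; rewrite inE. Qed.

Lemma matchable_perfect (T : finType) (e : rel T) :
  matchable e setT -> has_perfect_matching e.
Proof.
case/matchableP=> f fP.
have fK x : f (f x) = x by case: (fP x).
exists (fun x y => y == f x); split.
- by move=> x y; apply/eqP/eqP => ->; rewrite fK.
- by move=> x y /eqP ->; case: (fP x).
- move=> x; rewrite -(cards1 (f x)); apply: eq_card => y.
  by rewrite !inE.
Qed.

Lemma matchable_add (T : finType) (e : rel T) (A : {set T}) (x y : T) :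
  symmetric e -> x \notin A -> y \notin A -> x != y -> e x y ->
  matchable e A -> matchable e (x |: (y |: A)).
Proof.
move=> e_sym xA yA xy exy /matchableP[f fP]; apply/matchableP.
exists (fun z => if z == x then y else if z == y then x else f z) => z.
rewrite !inE; case: (eqVneq z x) => [->|zx] /=.
  by rewrite eq_sym (negPf xy) !eqxx orbT.
case: (eqVneq z y) => [->|zy] /= => [_|/fP[fA fK ez]].
  by rewrite !eqxx e_sym.
have /negPf-> : f z != x by apply: contraNneq xA => <-.
have /negPf-> : f z != y by apply: contraNneq yA => <-.
by [].
Qed.

Lemma matchable_del (T : finType) (e : rel T) (A : {set T}) (f : T -> T)
    (x : T) :
  (forall z, z \in A -> [/\ f z \in A, f (f z) = z & e z (f z)]) ->
  x \in A ->
  forall z, z \in A :\: [set x; f x] ->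
    [/\ f z \in A :\: [set x; f x], f (f z) = z & e z (f z)].
Proof.
move=> fP xA z; rewrite !inE negb_or => /andP[/andP[zx zfx] zA].
have [fA fK ez] := fP z zA; have [_ fKx _] := fP x xA.
split=> //; rewrite fA andbT negb_or; apply/andP; split.
  by apply: contraNneq zfx => <-; rewrite fK.
by apply: contraNneq zx => eqf; rewrite -fK eqf fKx.
Qed.

(** Matched pairs are removed one at a time; irreflexivity makes the two ends of a pair distinct. *)
Lemma even_matchable (T : finType) (e : rel T) (A : {set T}) :
  irreflexive e -> matchable e A -> ~~ odd #|A|.
Proof.
move=> e_irr /matchableP[f].
have [m] := ubnP #|A|; elim: m A => // m IHm A leAm fP.
have [->|[x xA]] := set_0Vmem A; first by rewrite cards0.
have [fxA _ exf] := fP x xA.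
have xfx : x != f x by apply: contraTneq exf => <-; rewrite e_irr.
have sub : [set x; f x] \subset A by rewrite subUset !sub1set xA.
have cardA : #|A| = #|A :\: [set x; f x]|.+2.
  by rewrite -(cardsID [set x; f x] A) (setIidPr sub) cards2 xfx.
rewrite cardA /= negbK; apply: IHm; last exact: matchable_del.
by rewrite cardA !ltnS in leAm *; apply: ltnW.
Qed.

(* Follow the alternating path [d, f1 d, f2 (f1 d), ...]. If it never meets [a]
   or [c], use [f1] on it and [f2] elsewhere; otherwise stop it at the first
   such vertex [s], use [f1] on it, join [s] to [b] and use [f2] elsewhere. *)
Lemma alternating_exchange (T : finType) (f1 f2 : T -> T) (a b c d : T) :
  involutive f1 -> involutive f2 ->
  (forall x, f1 x != x) -> (forall x, f2 x != x) ->
  f1 a = c -> f2 b = d -> d \notin [set a; c] -> b \notin [set a; c] ->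
  exists f : T -> T, involutive f /\
    forall x, [\/ f x = f1 x /\ x \notin [set a; c],
                  f x = f2 x /\ x \notin [set b; d]
                | exists2 s, s \in [set a; c] &
                    (x = s /\ f x = b) \/ (x = b /\ f x = s)].
Proof.
move=> f1K f2K f1N f2N f1a f2b dac bac.
have f1c : f1 c = a by rewrite -f1a f1K.
have f1ac x : (f1 x \in [set a; c]) = (x \in [set a; c]).
  by rewrite !inE !(inv_eq f1K) f1a f1c orbC.
pose q x := f2 (f1 x).
have q_inj : injective q by move=> x y /(inv_inj f2K) /(inv_inj f1K).
have f2d : f2 d = b by rewrite -f2b f2K.
(* The iterates of [q] from [d] are every second vertex of the alternating path. Testing them is
   enough, because [f1] preserves the pair [a], [c]. *)
have [/existsP[z /andP[zac dz]]|none] :=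
    boolP [exists z, (z \in [set a; c]) && fconnect q d z]; last first.
  (* The whole alternating cycle through [d]: it is closed under [f1] and [f2], contains [b] and
     avoids [a] and [c]. *)
  pose A := [set y | fconnect q d y || fconnect q d (f1 y)].
  have f1A y : (f1 y \in A) = (y \in A) by rewrite !inE f1K orbC.
  have f2Aw y : y \in A -> f2 y \in A.
    rewrite !inE => /orP[dy|dy].
      apply/orP; right; apply: connect_trans dy _.
      have yE : q (f1 (f2 y)) = y by rewrite /q f1K f2K.
      by rewrite (fconnect_sym q_inj) -{2}yE; exact: fconnect1.
    apply/orP; left; apply: connect_trans dy _.
    have -> : f2 y = q (f1 y) by rewrite /q f1K.
    exact: fconnect1.
  have f2A y : (f2 y \in A) = (y \in A).
    by apply/idP/idP => /f2Aw //; rewrite f2K.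
  have dA : d \in A by rewrite inE connect0.
  have bA : b \in A by rewrite -f2d f2A.
  have Aac y : y \in A -> y \notin [set a; c].
    rewrite inE => yA; apply: contraNN none => yac.
    by case/orP: yA => dy; apply/existsP; [exists y|exists (f1 y)];
      rewrite dy ?f1ac yac.
  exists (fun x => if x \in A then f1 x else f2 x); split.
    move=> x; have [xA|/negPf xA] := boolP (x \in A).
      by rewrite f1A xA f1K.
    by rewrite f2A xA f2K.
  move=> x; case: ifP => xA; first by apply: Or31; split=> //; exact: Aac.
  apply: Or32; split=> //; apply: contraFN xA.
  by rewrite in_set2 => /orP[] /eqP ->.
pose p i := iter i q d.
have exL : exists i, p i \in [set a; c].
  by exists (findex q d z); rewrite /p iter_findex.
case: (ex_minnP exL) => L pLac minL.
have pS i : p i.+1 = f2 (f1 (p i)) by [].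
have f1p i : f1 (p i) = f2 (p i.+1) by rewrite pS f2K.
have L_gt0 : 0 < L by case: L pLac {minL} => // dac'; rewrite dac' in dac.
have pac i : i < L -> p i \notin [set a; c].
  by apply: contraTN => /minL; rewrite -leqNgt.
(* In the dihedral group generated by [f1] and [f2], the word [f1 q^m] is a conjugate of [f1] or of
   [f2], hence has no fixed point. Each induction step strips one conjugation and lowers [m] by
   two. *)
have dihedral m : forall i, f1 (p i) != p (i + m).
  have [k] := ubnP m; elim: k m => // k IHk [|[|m]] ltmk i.
  - by rewrite addn0 f1N.
  - by rewrite addn1 pS eq_sym f2N.
  - have ltmk2 : m < k by exact: ltnW.
    apply: contraNneq (IHk m ltmk2 i.+1) => /eqP.
    rewrite f1p addnS pS (inj_eq (inv_inj f2K)) => /eqP ->.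
    by rewrite f1K addnS addSn.
(* The path strictly before its first vertex in the pair [a], [c]. This set is closed under [f1]
   only. *)
pose A := [set y | [exists i : 'I_L, (y == p i) || (y == f1 (p i))]].
have AP y : reflect (exists2 i, i < L & y = p i \/ y = f1 (p i)) (y \in A).
  rewrite inE; apply: (iffP existsP) => [[i /pred2P yi]|[i ltiL yi]].
    by exists i.
  by exists (Ordinal ltiL); apply/pred2P.
have dA : d \in A by apply/AP; exists 0; last by left.
have f1A y : (f1 y \in A) = (y \in A).
  have f1Aw x : x \in A -> f1 x \in A.
    by case/AP=> i ltiL [->|->]; apply/AP; exists i; rewrite ?f1K; auto.
  by apply/idP/idP => /f1Aw //; rewrite f1K.
have Aac y : y \in A -> y \notin [set a; c].
  by case/AP=> i /pac piac [->|->]; rewrite ?f1ac.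
have bA : b \notin A.
  apply/AP => -[i ltiL [bi|bi]].
    case: i => [|i] in ltiL bi.
      by move: (f2N d); rewrite f2d bi eqxx.
    have := dihedral i 0; rewrite add0n => /eqP[].
    apply: (can_inj f1K); rewrite f1K /=.
    by have := f2b; rewrite bi pS f2K => ->.
  (* The path would have returned to [d] after [i.+1] steps, so by periodicity it would meet the
     pair [a], [c] before step [L]. *)
  have di : p i.+1 = d by rewrite pS -bi.
  have [eqiL|ltSiL] := eqVneq i.+1 L.
    by move: dac; rewrite -di eqiL pLac.
  have leSiL : i.+1 <= L by [].
  have : p (L - i.+1) = p L.
    by rewrite -{2}(subnK leSiL) /p iterD -/(p i.+1) di.
  move=> pL; have := minL (L - i.+1); rewrite pL pLac => /(_ isT).
  by rewrite leqNgt ltn_subrL /= L_gt0.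
set s := p L; have sA : s \notin A by apply: contraTN pLac => /Aac.
have bs : b != s by apply: contraNneq bac => ->.
have f2B y : y \notin A -> y != b -> y != s ->
    [/\ f2 y \notin A, f2 y != b & f2 y != s].
  move=> yA yb ys; split.
  - apply/AP => -[[|i] ltiL [yi|yi]].
    + by move: yb; rewrite -(f2K y) yi f2d eqxx.
    + move: ltiL yA ys; rewrite -(f2K y) yi -pS leq_eqVlt.
      case/orP=> [/eqP->|lt1L] /AP yA; first by rewrite eqxx.
      by case: yA; exists 1; auto.
    + move/AP: yA; case; exists i; first exact: ltnW.
      by right; rewrite -(f2K y) yi f1p.
    + move: ltiL yA ys; rewrite -(f2K y) yi -pS leq_eqVlt.
      case/orP=> [/eqP->|lt1L] /AP yA; first by rewrite eqxx.
      by case: yA; exists i.+2; auto.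
  - by apply: contraNneq yA => f2y; rewrite -(f2K y) f2y f2b.
  - apply: contraNneq yA => f2y; apply/AP; exists L.-1.
      by rewrite prednK.
    by right; rewrite f1p prednK // -/s -f2y f2K.
exists (fun x => if x \in A then f1 x else if x == b then s
                 else if x == s then b else f2 x); split.
  move=> x; have [xA|xA] := boolP (x \in A); first by rewrite f1A xA.
  have [->|xb] := eqVneq x b.
    by rewrite (negPf sA) eq_sym (negPf bs) eqxx.
  have [->|xs] := eqVneq x s; first by rewrite (negPf bA) eqxx.
  have [/negPf-> /negPf-> /negPf->] := f2B x xA xb xs; exact: f2K.
move=> x; have [xA|xA] := boolP (x \in A).
  by apply: Or31; split=> //; exact: Aac.
have [->|xb] := eqVneq x b; first by apply: Or33; exists s => //; right.
have [->|xs] := eqVneq x s; first by apply: Or33; exists s => //; left.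
apply: Or32; split=> //; rewrite in_set2 negb_or xb /=.
by apply: contraNneq xA => ->.
Qed.
(** Let [A] be a largest matchable set. By parity at least two vertices [z1], [z2] are left over.
    [W] consists of these two and the partners of the vertices of [U]; an edge inside [W] would
    yield a matchable set larger than [A], by rematching universal vertices to leftover ones. *)
Lemma universal_transversal (T : finType) (e : rel T) (U : {set T}) :
  symmetric e -> irreflexive e -> ~~ odd #|T| -> ~~ matchable e setT ->
  (forall u x, u \in U -> x != u -> e u x) ->
  exists W : {set T},
    [/\ #|W| = #|U|.+2, [disjoint W & U]
      & forall w w', w \in W -> w' \in W -> ~~ e w w'].
Proof.
move=> e_sym e_irr evT nT univ.
have [A mA maxA] := @arg_maxnP _ set0 (matchable e) (fun A => #|A|)
  (matchable0 e).
have noext x y (B : {set T}) : matchable e B -> #|A| <= #|B| ->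
    x \notin B -> y \notin B -> x != y -> ~~ e x y.
  move=> mB leAB xB yB xy; apply/negP => exy.
  have := maxA _ (matchable_add e_sym xB yB xy exy mB).
  rewrite !cardsU1 yB !inE negb_or xy xB !add1n => leB.
  by have := leq_trans (leqnSn _) (leq_trans leB leAB); rewrite ltnn.
have noextA x y : x \notin A -> y \notin A -> ~~ e x y.
  have [->|xy] := eqVneq x y; first by rewrite e_irr.
  by move=> xA yA; apply: noext mA _ xA yA xy.
have [z1 [z2 [z1A z2A z12]]] :
    exists z1 z2, [/\ z1 \notin A, z2 \notin A & z1 != z2].
  have oddC : ~~ odd #|~: A|.
    by have := evT; rewrite -(cardsC A) oddD (negPf (even_matchable e_irr mA)).
  have [C0|[z1]] := set_0Vmem (~: A).
    by move: nT; rewrite -(setCK A) C0 setC0 in mA *; rewrite mA.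
  rewrite inE => z1A.
  have [C0|[z2]] := set_0Vmem (~: A :\ z1).
    by move: oddC; rewrite (cardsD1 z1) C0 cards0 inE z1A.
  by rewrite !inE => /andP[z21 z2A]; exists z1, z2; rewrite eq_sym.
have other z : z \notin A -> exists2 z', z' \notin A & z != z'.
  have [->|zz1] := eqVneq z z1; first by exists z2.
  by exists z1.
have UA u : u \in U -> u \in A.
  move=> uU; apply/negPn/negP => uA; have [z zA uz] := other u uA.
  by have := noextA u z uA zA; rewrite univ // eq_sym.
have /matchableP[f fP] := mA.
have neqA x y : x \in A -> y \notin A -> (x == y) = false.
  by move=> xA; apply: contraNF => /eqP <-.
have pairP u : u \in U ->
    [/\ f u \in A, (f u == u) = false & #|A| = #|A :\: [set u; f u]|.+2].
  move=> uU; have uA := UA u uU; have [fuA _ eufu] := fP u uA.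
  have fuu : (f u == u) = false by apply: contraTF eufu => /eqP ->; rewrite e_irr.
  split=> //; rewrite -(cardsID [set u; f u] A) (setIidPr _).
    by rewrite cards2 eq_sym fuu.
  by rewrite subUset !sub1set uA.
(* Rematch [u] to another leftover vertex [z']. The new set has as many vertices as [A], and an edge
   from the freed [f u] to [z] would extend it. *)
have fU u z : u \in U -> z \notin A -> ~~ e (f u) z.
  move=> uU zA; have [z' z'A zz'] := other z zA.
  have uA := UA u uU; have [fuA fuu cardA] := pairP u uU.
  set D := A :\: [set u; f u] in cardA.
  have ND x : x \notin A -> x \notin D.
    by rewrite inE => /negPf->; rewrite andbF.
  have uD : u \notin D by rewrite !inE eqxx.
  have fuD : f u \notin D by rewrite !inE eqxx orbT.
  have mD : matchable e D.
    by apply/matchableP; exists f; apply: matchable_del.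
  have mB : matchable e (u |: (z' |: D)).
    apply: (matchable_add e_sym) mD; rewrite ?(ND z') ?neqA //.
    by rewrite univ // eq_sym neqA.
  apply: noext mB _ _ _ _.
  - by rewrite !cardsU1 in_setU1 negb_or neqA // (ND z') // uD cardA.
  - by rewrite !in_setU1 fuu neqA.
  - by rewrite !in_setU1 negb_or eq_sym neqA //= negb_or zz' ND.
  - by rewrite neqA.
have fuU u : u \in U -> f u \notin U.
  move=> uU; apply/negP => fuU; have := fU u z1 uU z1A.
  by rewrite univ // eq_sym neqA //; case: (pairP u uU).
have finj : {in U &, injective f}.
  move=> u u' /UA uA /UA u'A eqf.
  by have [_ <- _] := fP u uA; have [_ <- _] := fP u' u'A; rewrite eqf.
(* Likewise with two pairs broken: [u] goes to [z1] and [u'] to [z2], which frees [f u] and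
   [f u']. *)
have fUU u u' : u \in U -> u' \in U -> ~~ e (f u) (f u').
  move=> uU u'U; have [->|uu'] := eqVneq u u'; first by rewrite e_irr.
  have uA := UA u uU; have [fuA fuu cardA] := pairP u uU.
  have u'A := UA u' u'U; have [fu'A fu'u' _] := pairP u' u'U.
  have fuu' : (f u == u') = false.
    by apply: contraTF u'U => /eqP <-; apply: fuU.
  have fu'u : (f u' == u) = false.
    by apply: contraTF uU => /eqP <-; apply: fuU.
  have fufu' : (f u == f u') = false.
    by apply: contraNF uu' => /eqP /finj ->.
  pose D := A :\: [set u; f u].
  have fPD : forall x, x \in D -> [/\ f x \in D, f (f x) = x & e x (f x)].
    exact: matchable_del.
  have u'D : u' \in D by rewrite !inE negb_or eq_sym uu' eq_sym fuu'.
  have [fu'D _ _] := fPD u' u'D.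
  pose D' := D :\: [set u'; f u'].
  have cardD : #|D| = #|D'|.+2.
    rewrite -(cardsID [set u'; f u'] D) (setIidPr _).
      by rewrite cards2 eq_sym fu'u'.
    by rewrite subUset !sub1set u'D.
  have mD' : matchable e D'.
    by apply/matchableP; exists f; apply: matchable_del.
  have subDA x : x \in D' -> x \in A.
    by rewrite !inE => /andP[_ /andP[]].
  have ND x : x \notin A -> x \notin D' by apply: contraNN => /subDA.
  have [uD fuD u'D' fu'D'] : [/\ u \notin D', f u \notin D', u' \notin D'
                               & f u' \notin D'].
    by rewrite !inE !eqxx !orbT !andbF.
  have mB : matchable e (u |: (z1 |: D')).
    apply: (matchable_add e_sym) mD'; rewrite ?(ND z1) ?neqA //.
    by rewrite univ // eq_sym neqA.
  have mC : matchable e (u' |: (z2 |: (u |: (z1 |: D')))).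
    apply: (matchable_add e_sym) mB; rewrite ?neqA //.
    - by rewrite !in_setU1 negb_or eq_sym uu' neqA.
    - rewrite !in_setU1 !negb_or (eq_sym z2 u) neqA //.
      by rewrite (eq_sym z2 z1) z12 ND.
    - by rewrite univ // eq_sym neqA.
  apply: noext mC _ _ _ _.
  - rewrite !cardsU1 !in_setU1 (neqA u' z2) // (neqA u' z1) //.
    rewrite (neqA u z1) // (eq_sym u' u) (negPf uu') (eq_sym z2 u) neqA //.
    rewrite (eq_sym z2 z1) (negPf z12) (negPf u'D') (negPf uD).
    by rewrite (negPf (ND z1 z1A)) (negPf (ND z2 z2A)) cardA -/D cardD.
  - by rewrite !in_setU1 fuu' fuu !(neqA (f u)) //= orbF.
  - by rewrite !in_setU1 fu'u' fu'u !(neqA (f u')).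
  - by rewrite fufu'.
have zU z : z \notin A -> z \notin U by apply: contraNN => /UA.
have zf z : z \notin A -> z \notin f @: U.
  move=> zA; apply/imsetP => -[u uU zu].
  by move: zA; rewrite zu; case: (pairP u uU) => ->.
exists (z1 |: (z2 |: f @: U)); split.
- by rewrite !cardsU1 in_setU1 negb_or z12 (zf z1) // (zf z2) // card_in_imset.
- rewrite disjoint_subset; apply/subsetP => x; rewrite !inE.
  by case/or3P=> [/eqP->|/eqP->|/imsetP[u uU ->]]; [exact: zU|exact: zU|exact: fuU].
- move=> w w'; rewrite !inE.
  case/or3P=> [/eqP->|/eqP->|/imsetP[u uU ->]];
    case/or3P=> [/eqP->|/eqP->|/imsetP[u' u'U ->]];
    by [exact: noextA|exact: fUU|exact: fU|rewrite e_sym; exact: fU].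
Qed.

(* Lovasz's argument: in an edge-maximal counterexample the non-universal
   vertices induce a disjoint union of cliques, and a maximum matching of such
   a graph exposes the transversal [W]. *)
Lemma tutte_transversal (T : finType) (e : rel T) :
  symmetric e -> irreflexive e -> ~~ odd #|T| -> ~~ matchable e setT ->
  exists (U W : {set T}) (c : T -> T),
    [/\ #|W| = #|U|.+2, forall x, x \notin U -> c x \in W,
        forall w, w \in W -> w \notin U /\ c w = w
      & forall x y, x \notin U -> y \notin U -> e x y -> c x = c y].
Proof.
move=> e_sym e_irr evT nT.
(* Graphs are coded as sets of ordered pairs so that an inclusion-maximal one without a perfect
   matching can be taken. *)
pose rel_of (E : {set T * T}) : rel T := fun x y => (x, y) \in E.
pose good E := [&& [forall x, forall y, rel_of E x y ==> rel_of E y x],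
                   [forall x, ~~ rel_of E x x] & ~~ matchable (rel_of E) setT].
pose E0 := [set xy | e xy.1 xy.2].
have E0E x y : rel_of E0 x y = e x y by rewrite /rel_of inE.
have mono (e1 e2 : rel T) : subrel e1 e2 ->
    matchable e1 setT -> matchable e2 setT.
  move=> sub /matchableP[f fP]; apply/matchableP; exists f => x /fP[? ? ?].
  by split=> //; apply: sub.
have gE0 : good E0.
  apply/and3P; split.
  - by apply/'forall_forallP => x y; rewrite !E0E e_sym; apply/implyP.
  - by apply/forallP => x; rewrite E0E e_irr.
  - by apply: contraNN nT; apply: mono => x y; rewrite E0E.
have [E /maxsetP[/and3P[symE irrE nE] maxE] subE] := maxset_exists gE0.
set e' := rel_of E.
have e'_sym : symmetric e'.
  have sub x y : e' x y -> e' y x.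
    by move: (forallP symE x) => /forallP /(_ y) /implyP.
  by move=> x y; apply/idP/idP => /sub.
have e'_irr : irreflexive e' by move=> x; apply/negbTE/(forallP irrE).
have sub_e x y : e x y -> e' x y.
  by rewrite -E0E; apply: (subsetP subE).
(* By maximality, adding a missing edge creates a perfect matching, and that matching must use the
   new edge. *)
have addE x y : x != y -> ~~ e' x y ->
    exists f : T -> T, [/\ involutive f, forall z, f z != z, f x = y
      & forall z, [\/ e' z (f z), z = x /\ f z = y | z = y /\ f z = x]].
  move=> xy nxy; pose E2 := (x, y) |: ((y, x) |: E).
  have E2E u v : rel_of E2 u v = [|| (u == x) && (v == y),
      (u == y) && (v == x) | e' u v].
    by rewrite /rel_of !inE !xpair_eqE.
  have : ~~ good E2.
    apply: contraNN nxy => gE2; have := maxE _ gE2; rewrite /e' /rel_of => <-.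
      by rewrite !inE eqxx.
    by apply/subsetP => u; rewrite !inE => ->; rewrite !orbT.
  have -> : good E2 = ~~ matchable (rel_of E2) setT.
    rewrite /good; have -> : [forall x, forall y, rel_of E2 x y ==> rel_of E2 y x].
      apply/'forall_forallP => u v; rewrite !E2E e'_sym.
      by apply/implyP => /or3P[/andP[-> ->]|/andP[-> ->]|->]; rewrite ?orbT.
    have -> // : [forall x, ~~ rel_of E2 x x].
    apply/forallP => u; rewrite E2E e'_irr orbF; apply: contraNN xy.
    by case/orP=> /andP[/eqP <- /eqP <-].
  rewrite negbK => /matchableP[f fP].
  have fK z : f (f z) = z by case: (fP z).
  have fE z : [\/ e' z (f z), z = x /\ f z = y | z = y /\ f z = x].
    have [_ _] := fP z (in_setT z); rewrite E2E.
    case/or3P=> [/andP[/eqP ? /eqP ?]|/andP[/eqP ? /eqP ?]|?];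
      by [apply: Or31|apply: Or32|apply: Or33].
  exists f; split=> //.
    move=> z; apply/eqP => fz.
    case: (fE z); rewrite fz; first by rewrite e'_irr.
      by case=> -> /eqP; rewrite (negPf xy).
    by case=> -> /eqP; rewrite eq_sym (negPf xy).
  apply/eqP/negPn/negP => fxy; case/negP: nE; apply/matchableP; exists f => z _.
  split=> //; case: (fE z) => // -[zE fz].
    by move: fxy; rewrite -zE fz eqxx.
  by move: fxy; rewrite -fz fK zE eqxx.
pose U := [set u | [forall x, (x != u) ==> e' u x]].
have univ u x : u \in U -> x != u -> e' u x.
  by rewrite inE => /forallP/(_ x)/implyP.
(* If [b] is not universal it misses some [d]. The matchings obtained by adding [a c] and [b d] are
   merged by the exchange lemma into one that uses only edges of [e'], since [b] is adjacent to both
   [a] and [c]. *)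
have e'_trans a b c : b \notin U -> a != c -> e' a b -> e' b c -> e' a c.
  rewrite inE negb_forall => /existsP[d]; rewrite negb_imply => /andP[db nbd].
  move=> ac eab ebc; apply/negPn/negP => nac.
  have [f1 [f1K f1N f1a f1E]] := addE a c ac nac.
  have bd : b != d by rewrite eq_sym.
  have [f2 [f2K f2N f2b f2E]] := addE b d bd nbd.
  have dac : d \notin [set a; c].
    rewrite in_set2; apply/negP => /orP[] /eqP dE; case/negP: nbd; rewrite dE //.
    by rewrite e'_sym.
  have bac : b \notin [set a; c].
    rewrite in_set2; apply/negP => /orP[] /eqP bE.
      by rewrite bE e'_irr in eab.
    by rewrite bE e'_irr in ebc.
  have [f [fK fE]] := alternating_exchange f1K f2K f1N f2N f1a f2b dac bac.
  case/negP: nE; apply/matchableP; exists f => x _; split=> //.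
  case: (fE x) => [[-> xac]|[-> xbd]|[s sac sb]].
  - by case: (f1E x) => // -[xE _]; rewrite xE !inE eqxx ?orbT in xac.
  - by case: (f2E x) => // -[xE _]; rewrite xE !inE eqxx ?orbT in xbd.
  - have esb : e' s b.
      by move: sac; rewrite in_set2 => /orP[] /eqP ->; rewrite // e'_sym.
    by case: sb => -[-> ->] //; move: esb; rewrite e'_sym.
have [W [cardW WU Windep]] := universal_transversal e'_sym e'_irr evT nE univ.
have /set0Pn[w0 w0W] : W != set0 by rewrite -card_gt0 cardW.
pose P x w := (w \in W) && ((x == w) || e' x w).
(* The representative in [W] of the clique of [x]. Cliques that miss [W] are all lumped into the
   class of [w0], so a class may be a union of several cliques. *)
pose c x := odflt w0 (pick (P x)).
have cW x : c x \in W by rewrite /c; case: pickP => [w /andP[]|].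
exists U, W, c; split=> // [w wW|x y xU yU /sub_e exy].
  split; first by apply: contraTN wW => wU; rewrite (disjointFl WU).
  rewrite /c; case: pickP => [w' /andP[w'W]|/(_ w)]; last by rewrite /P wW eqxx.
  by rewrite (negPf (Windep _ _ wW w'W)) orbF => /eqP.
congr (odflt _ _); apply: eq_pick => w; rewrite /P.
have sub x' y' : x' \notin U -> e' x' y' -> (x' == w) || e' x' w ->
    (y' == w) || e' y' w.
  move=> x'U exy' /orP[/eqP <-|exw]; first by rewrite e'_sym exy' orbT.
  have [//|yw] := eqVneq y' w.
  by rewrite (e'_trans y' x' w) // e'_sym.
by congr andb; apply/idP/idP; apply: sub; rewrite // e'_sym.
Qed.

(** * Spectral bound *)

Import Order.TTheory GRing.Theory Num.Theory.
Local Open Scope ring_scope.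

(** Evaluate the eigenvector equation at the index [j] where [|v j| / y j] is largest: with [M] this
    maximum, every [|v i|] is at most [M * y i]. *)
Lemma eigenvalue_le_test_vector (R : realFieldType) (n : nat) (A : 'M[R]_n)
    (y : 'I_n -> R) (lam rho : R) :
  (forall i j, 0 <= A i j) -> (forall i, 0 < y i) ->
  (forall j, \sum_i y i * A i j <= lam * y j) ->
  eigenvalue A rho -> rho <= lam.
Proof.
move=> A_ge0 y_gt0 yA /eigenvalueP[v vA v_neq0].
have [i0 vi0] : exists i, v 0 i != 0 by apply/rV0Pn.
case: (arg_maxP (fun i => `|v 0 i| / y i) (isT : xpredT i0)) => j _ maxj.
set M := `|v 0 j| / y j in maxj.
have M_gt0 : 0 < M.
  by apply: lt_le_trans (maxj i0 isT); rewrite divr_gt0 ?normr_gt0.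
have vj : `|v 0 j| = M * y j by rewrite /M divfK // gt_eqF.
have vj_gt0 : 0 < `|v 0 j| by rewrite vj mulr_gt0.
rewrite -(ler_pM2r vj_gt0); apply: le_trans (_ : `|rho * v 0 j| <= _).
  by rewrite normrM ler_pM2r // ler_norm.
have -> : rho * v 0 j = \sum_i v 0 i * A i j.
  by have /rowP/(_ j) := vA; rewrite !mxE => ->.
apply: le_trans (ler_norm_sum _ _ _) _.
apply: le_trans (_ : M * \sum_i y i * A i j <= _); last first.
  by rewrite vj mulrCA ler_pM2l.
rewrite mulr_sumr; apply: ler_sum => i _.
rewrite normrM (ger0_norm (A_ge0 i j)) mulrA ler_wpM2r //.
by rewrite -ler_pdivrMr //; exact: maxj.
Qed.

Lemma spectral_radius_le (R : realType) (T : finType) (e : rel T)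
    (y : T -> R) (lam rho : R) :
  (forall x, 0 < y x) ->
  (forall x, \sum_z y z * (e z x)%:R <= lam * y x) ->
  is_spectral_radius e rho -> rho <= lam.
Proof.
move=> y_gt0 ye [eig _]; apply: eigenvalue_le_test_vector eig.
- by move=> i j; rewrite mxE ler0n.
- by move=> i; exact: (y_gt0 (enum_val i)).
- move=> j /=; apply: le_trans (ye (enum_val j)).
  rewrite [leRHS](reindex (@enum_val T T)) /=; last first.
    by apply: onW_bij; exact: enum_val_bij.
  by apply: ler_sum => i _; rewrite mxE.
Qed.

Lemma sum_indicator (R : nzRingType) (T : finType) (S : {set T}) (b : R) :
  \sum_z (z \in S)%:R * b = #|S|%:R * b.
Proof.
rewrite -mulr_suml -natr_sum -sum1_card [in RHS]big_mkcond /=.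
by congr (_%:R * _); apply: eq_bigr => z _; case: ifP.
Qed.

(* The chord of the convex function [s / (lam + 1 - s)] over [1, m]. *)
Lemma fraction_le_chord (R : realFieldType) (lam m s : R) :
  0 < lam -> 0 < lam + 1 - m -> 1 <= s -> s <= m ->
  s / (lam + 1 - s) <=
    lam^-1 + (s - 1) * ((lam + 1) / ((lam + 1 - m) * lam)).
Proof.
move=> lam_gt0 a_gt0 s_ge1 s_lem.
have as_gt0 : 0 < lam + 1 - s by lra.
have -> : s / (lam + 1 - s) =
    lam^-1 + (s - 1) * ((lam + 1) / ((lam + 1 - s) * lam)).
  by field; rewrite !gt_eqF.
rewrite lerD2l; apply: ler_wpM2l; first by rewrite subr_ge0.
apply: ler_wpM2l; first by lra.
by rewrite lef_pV2 ?posrE ?mulr_gt0 // ler_pM2r //; lra.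
Qed.

(* [y] is 1 on [X] and [x / (lam + 1 - s)] on a class of size [s]: the row
   inequality is tight off [X] for the join, and on [X] it follows from convexity
   of the contribution of a class as a function of its size. *)
Lemma spectral_radius_join_cliques (R : realType) (T : finType) (e : rel T)
    (X W : {set T}) (c : T -> T) (lam m rho : R) :
  irreflexive e -> X != set0 ->
  (forall z, z \notin X -> c z \in W) ->
  (forall w, w \in W -> w \notin X /\ c w = w) ->
  (forall x y, x \notin X -> y \notin X -> e x y -> c x = c y) ->
  #|T|%:R = #|X|%:R + (#|W|%:R - 1) + m ->
  0 < lam -> 0 < lam + 1 - m ->
  0 <= (lam - #|X|%:R + 1) * lam * (lam + 1 - m)
       - #|X|%:R * (#|W|%:R - 1) * (lam + 1 - m) - #|X|%:R * m * lam ->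
  is_spectral_radius e rho -> rho <= lam.
Proof.
move=> e_irr X0 cW Wc ec cardT lam_gt0 a_gt0 g_ge0.
set x : R := #|X|%:R in cardT g_ge0; set t : R := #|W|%:R in cardT g_ge0.
have x_gt0 : 0 < x by rewrite ltr0n card_gt0.
pose C w := [set z | (z \notin X) && (c z == w)].
pose s w : R := #|C w|%:R.
have s_ge1 w : w \in W -> 1 <= s w.
  move=> wW; rewrite ler1n card_gt0; apply/set0Pn; exists w; rewrite inE.
  by have [-> ->] := Wc w wW; rewrite eqxx.
have sum_s : \sum_(w in W) s w = t - 1 + m.
  have : #|T| = (#|X| + \sum_(w in W) #|C w|)%N.
    rewrite -(cardsC X); congr addn; rewrite -sum1_card.
    rewrite (partition_big c (mem W)) /=; last by move=> z; rewrite inE => /cW.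
    by apply: eq_bigr => w _; rewrite sum1dep_card; apply: eq_card => z; rewrite !inE.
  move=> cardTN; have : #|T|%:R = x + \sum_(w in W) s w.
    by rewrite cardTN natrD natr_sum.
  by rewrite cardT => eqx; move: eqx; set S := \sum_(w in W) _; lra.
(* Every other class contains its own representative, so [m] is the size left for one class when all
   the others are singletons. *)
have s_lem w : w \in W -> s w <= m.
  move=> wW; have : \sum_(w' in W | w' != w) (1 : R) = t - 1.
    apply: (addrI 1); rewrite [RHS]addrC subrK /t -sum1_card natr_sum.
    by rewrite [RHS](bigD1 w).
  move=> sum1; move: sum_s; rewrite (bigD1 w) //=.
  have : \sum_(w' in W | w' != w) (1 : R) <= \sum_(w' in W | w' != w) s w'.
    by apply: ler_sum => w' /andP[/s_ge1].
  rewrite sum1; set S := \sum_(_ in _ | _) _; lra.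
have as_gt0 w : w \in W -> 0 < lam + 1 - s w by move/s_lem; lra.
pose b w := x / (lam + 1 - s w).
have b_gt0 w : w \in W -> 0 < b w by move=> /as_gt0 ?; rewrite divr_gt0.
pose y z := if z \in X then 1 else b (c z).
apply: (spectral_radius_le (y := y)) => [z|v].
  by rewrite /y; case: ifPn => // /cW /b_gt0.
have y_ge0 z : 0 <= y z by rewrite /y; case: ifPn => // /cW /b_gt0 /ltW.
have [vX|vX] := boolP (v \in X).
  apply: le_trans (_ : \sum_z ((z \in X :\ v)%:R * 1 +
      (if z \notin X then b (c z) else 0)) <= _).
    apply: ler_sum => z _; rewrite /y in_setD1; case: ifPn => zX /=.
      rewrite addr0 mulr1 mul1r; case: eqVneq => [->|_] /=.
        by rewrite e_irr.
      by rewrite ler_nat leq_b1.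
    rewrite andbF mul0r add0r ler_piMr ?lern1 ?leq_b1 //.
    by have := b_gt0 _ (cW z zX); lra.
  rewrite big_split sum_indicator -big_mkcond /= mulr1.
  rewrite (partition_big c (mem W)) /=; last by move=> z /cW.
  have -> : #|X :\ v|%:R = x - 1.
    by rewrite /x (cardsD1 v X) vX natrD [in RHS]addrC addKr.
  have -> : \sum_(w in W) \sum_(z | (z \notin X) && (c z == w)) b (c z) =
      x * \sum_(w in W) s w / (lam + 1 - s w).
    rewrite mulr_sumr; apply: eq_bigr => w _.
    rewrite (eq_bigr (fun=> b w)) => [|z /andP[_ /eqP->]//].
    rewrite sumr_const -mulr_natl /b mulrCA; congr (_ * (_%:R * _)).
    by rewrite /C; apply: eq_card => z; rewrite !inE.
  rewrite /y vX mulr1.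
  (* The excesses [s w - 1] sum to [m - 1], so the chords add up to the value for one class of size
     [m] and singletons elsewhere. *)
  have : \sum_(w in W) s w / (lam + 1 - s w) <= t / lam +
      (m - 1) * ((lam + 1) / ((lam + 1 - m) * lam)).
    apply: le_trans (_ : \sum_(w in W) (lam^-1 +
        (s w - 1) * ((lam + 1) / ((lam + 1 - m) * lam))) <= _).
      by apply: ler_sum => w wW; apply: fraction_le_chord; auto.
    rewrite big_split /= -mulr_suml sumrB sum_s !sumr_const -/t.
    rewrite -(mulr_natl lam^-1) -/t.
    by have -> : t - 1 + m - t = m - 1 by ring.
  set S := \sum_(w in W) _ => leS.
  apply: le_trans (_ : x - 1 + x * (t / lam +
      (m - 1) * ((lam + 1) / ((lam + 1 - m) * lam))) <= _).
    by rewrite lerD2l ler_pM2l.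
  rewrite -subr_ge0.
  (* The polynomial assumed nonnegative is exactly this row inequality with denominators cleared. *)
  have -> : lam - (x - 1 + x * (t / lam +
      (m - 1) * ((lam + 1) / ((lam + 1 - m) * lam)))) =
    ((lam - x + 1) * lam * (lam + 1 - m)
       - x * (t - 1) * (lam + 1 - m) - x * m * lam) / ((lam + 1 - m) * lam).
    by field; rewrite !gt_eqF.
  by rewrite divr_ge0 // mulr_ge0 // ltW.
have cvW := cW v vX.
apply: le_trans (_ : \sum_z ((z \in X)%:R * 1 +
    (z \in C (c v) :\ v)%:R * b (c v)) <= _).
  apply: ler_sum => z _; rewrite /y in_setD1 inE; case: ifPn => zX /=.
    by rewrite andbF mul0r addr0 mulr1 mul1r ler_nat leq_b1.
  rewrite mul0r add0r; have [ezv|_] := boolP (e z v); last first.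
    by rewrite mulr0 mulr_ge0 ?ler0n // ltW // b_gt0.
  rewrite (ec z v zX vX ezv) eqxx andbT.
  have -> : z != v by apply: contraTneq ezv => ->; rewrite e_irr.
  by rewrite mulr1 mul1r.
rewrite big_split /= !sum_indicator mulr1 -/x /y (negPf vX).
have -> : #|C (c v) :\ v|%:R = s (c v) - 1.
  by rewrite /s (cardsD1 v (C _)) inE vX eqxx natrD [in RHS]addrC addKr.
have := as_gt0 _ cvW; rewrite /b; set q := s (c v) => q_gt0.
rewrite le_eqVlt; apply/orP; left; apply/eqP.
by field; rewrite gt_eqF.
Qed.

(** * Obstructions to factor-criticality and reduction to two inequalities *)

(** Tutte's theorem in [G - Q] gives [U] and [W]; then [X] is [Q] together with [U], and [j] is
    [#|U| - 1]. *)
Lemma unmatchable_split (k : nat) (T : finType) (e : rel T) (Q : {set T}) :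
  symmetric e -> irreflexive e -> vertex_connected k.+1 e ->
  #|T| = k %[mod 2] -> #|Q| = k -> ~~ matchable (@del_vertices T e Q) setT ->
  exists (j : nat) (X W : {set T}) (c : T -> T),
    [/\ #|X| = (k + 1 + j)%N, #|W| = (j + 3)%N,
        forall z, z \notin X -> c z \in W,
        forall w, w \in W -> w \notin X /\ c w = w
      & forall x y, x \notin X -> y \notin X -> e x y -> c x = c y].
Proof.
move=> e_sym e_irr [_ conn] parT cardQ nM.
have cardT' : #|{: {x : T | x \notin Q}}| = (#|T| - k)%N.
  rewrite card_sig -cardQ -(cardsC Q) addKn.
  by apply: eq_card => z; rewrite !inE.
have evT' : ~~ odd #|{: {x : T | x \notin Q}}|.
  rewrite cardT'; move/eqP: parT; rewrite !modn2 -cardQ => par.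
  by rewrite oddB ?max_card //; case: (odd _) par; case: (odd _).
have [||U [W [c [cardW cW Wc ec]]]] := tutte_transversal _ _ evT' nM.
- by move=> x y; exact: e_sym.
- by move=> x; exact: e_irr.
have U0 : (0 < #|U|)%N.
  (* Were [U] empty, the two representatives in [W] would lie in different components of [G - Q],
     although removing [k] vertices keeps the graph connected. *)
  rewrite card_gt0; apply/eqP => U0; move: cardW; rewrite U0 cards0 => cardW.
  have notU z : z \notin U by rewrite U0 inE.
  have /card_gt1P[w [w' [wW w'W]]] : (1 < #|W|)%N by rewrite cardW.
  case/negP; rewrite -(Wc _ wW).2 -(Wc _ w'W).2.
  have Qk : (#|Q| < k.+1)%N by rewrite cardQ.
  have clos : closed (@del_vertices T e Q) [pred z | c w == c z].
    by move=> x y exy; rewrite !inE (ec x y).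
  by have := closed_connect clos (conn Q Qk w w'); rewrite !inE eqxx => <-.
(* The default [z] is reached only on [Q], which lies inside the new [X]. *)
pose c' z := if insub z is Some z' then val (c z') else z.
have c'E z' : c' (val z') = val (c z') by rewrite /c' valK.
have XP z : z \notin Q :|: val @: U -> exists2 z', z = val z' & z' \notin U.
  rewrite in_setU negb_or => /andP[zQ zU]; exists (Sub z zQ).
    by rewrite SubK.
  by apply: contraNN zU => zU; apply/imsetP; exists (Sub z zQ); rewrite ?SubK.
exists #|U|.-1, (Q :|: val @: U), (val @: W), c'; split.
- rewrite cardsU (disjoint_setI0 _) ?cards0 ?subn0 ?card_imset ?cardQ //.
  + by rewrite -addnA add1n prednK.
  + exact: val_inj.
  + rewrite disjoint_sym disjoint_subset; apply/subsetP => z.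
    by case/imsetP => z' _ ->; rewrite inE (valP z').
- by rewrite card_imset ?cardW; [rewrite addnS addn2 prednK|exact: val_inj].
- by move=> z /XP[z' -> z'U]; rewrite c'E imset_f // cW.
- move=> w /imsetP[w' w'W ->]; have [w'U cw'] := Wc w' w'W.
  split; last by rewrite c'E cw'.
  rewrite in_setU negb_or (valP w'); apply: contraNN w'U.
  by case/imsetP => u uU /val_inj ->.
- move=> x y /XP[x' -> x'U] /XP[y' -> y'U] exy.
  by rewrite !c'E (ec x' y').
Qed.

(* The conclusion says that [lam] is at least the spectral radius of the join of
   K_x with the disjoint union of K_m and x - k + 1 isolated vertices. *)
Lemma characteristic_interpolation (R : realFieldType) (k r j lam : R) :
  0 <= k -> 0 <= j -> j <= r -> k + 1 + 2 * r <= lam ->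
  let n := k + 4 + 2 * r in
  let m := 2 * (r - j) + 1 in
  let x := k + 1 + j in
  0 <= lam ^+ 3 - (n - 4) * lam ^+ 2 - (n + 2 * k - 1) * lam
       + 2 * (k + 1) * (n - k - 4) ->
  (0 < r -> 0 <= lam ^+ 2 - (k + r) * lam - (k + 1 + r) * (r + 3)) ->
  0 <= (lam - x + 1) * lam * (lam + 1 - m) - x * (j + 2) * (lam + 1 - m)
       - x * m * lam.
Proof.
move=> k_ge0 j_ge0 j_ler lam_ge n m x.
set g0 := (X in 0 <= X -> _); set g := (X in _ -> _ -> 0 <= X) => g0_ge0.
have [r_gt0 /(_ isT) H_ge0|r_le0 _] := ltP 0 r; last first.
  have -> // : g = g0.
  have r0 : r = 0 by lra.
  have j0 : j = 0 by lra.
  by rewrite /g /g0 /x /m /n r0 j0; ring.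
rewrite -(pmulr_rge0 _ r_gt0).
(* Interpolation in [j] between 0 and [r]: the weights are [r - j] and [j], the value at [j = r] is
   [lam] times the quadratic, and the last summand is the nonnegative excess over the chord. *)
have -> : r * g = (r - j) * g0
    + j * (lam * (lam ^+ 2 - (k + r) * lam - (k + 1 + r) * (r + 3)))
    + r * j * (r - j) * ((lam - 2 * r) + 2 * (k + 1) + 4 + 2 * (j + r)).
  by rewrite /g /g0 /x /m /n; ring.
have lam_ge0 : 0 <= lam by lra.
by rewrite !addr_ge0 // !mulr_ge0 // ?subr_ge0; lra.
Qed.

(** The inequalities at the two extreme values of [j] serve for every obstruction. For [r = 0] the
    extremes coincide, hence the guard on the quadratic. *)
Lemma factor_critical_of_spectral_radius (R : realType) (k r : nat)
    (T : finType) (e : rel T) (lam rho : R) :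
  symmetric e -> irreflexive e -> vertex_connected k.+1 e ->
  #|T| = (k + 4 + 2 * r)%N ->
  k%:R + 1 + 2 * r%:R <= lam ->
  0 <= lam ^+ 3 - (#|T|%:R - 4) * lam ^+ 2 - (#|T|%:R + 2 * k%:R - 1) * lam
       + 2 * (k%:R + 1) * (#|T|%:R - k%:R - 4) ->
  ((0 < r)%N ->
     0 <= lam ^+ 2 - (k%:R + r%:R) * lam - (k%:R + 1 + r%:R) * (r%:R + 3)) ->
  is_spectral_radius e rho -> lam < rho -> factor_critical k e.
Proof.
move=> e_sym e_irr e_conn cardT lam_ge g0_ge0 H_ge0 rhoP lam_lt Q cardQ.
have [/matchable_perfect //|nM] := boolP (matchable (@del_vertices T e Q) setT).
have parT : #|T| = k %[mod 2].
  by rewrite cardT -addnA -modnDmr -{2}(addn0 k) -[in RHS]modnDmr; congr (_ %% _)%N; lia.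
have [j [X [W [c [cardX cardW cW Wc ec]]]]] :=
  unmatchable_split e_sym e_irr e_conn parT cardQ nM.
(* [X] and [W] are disjoint, and their sizes add up to [k + 4 + 2 * j]. *)
have le_jr : (j <= r)%N.
  have : (#|X| + #|W| <= #|T|)%N.
    rewrite -(cardsC X) leq_add2l; apply/subset_leq_card/subsetP => w /Wc[].
    by rewrite inE.
  by rewrite cardX cardW cardT; lia.
have cardTR : #|T|%:R = k%:R + 4 + 2 * r%:R :> R by rewrite cardT natrD natrM natrD.
have cardXR : #|X|%:R = k%:R + 1 + j%:R :> R by rewrite cardX 2!natrD.
have cardWR : #|W|%:R = j%:R + 3 :> R by rewrite cardW natrD.
have k_ge0 : 0 <= k%:R :> R by rewrite ler0n.
have j_ge0 : 0 <= j%:R :> R by rewrite ler0n.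
have j_ler : j%:R <= r%:R :> R by rewrite ler_nat.
move: lam_lt; rewrite ltNge => /negP[].
apply: (@spectral_radius_join_cliques _ _ e X W c lam (2 * (r%:R - j%:R) + 1));
  rewrite ?cardTR ?cardXR ?cardWR //.
- by rewrite -card_gt0 cardX addnAC addn1.
- by ring.
- by lra.
- by lra.
- rewrite cardTR in g0_ge0.
  have -> : j%:R + 3 - 1 = j%:R + 2 :> R by ring.
  apply: characteristic_interpolation => //.
  by rewrite ltr0n.
Qed.

(** * The extremal polynomials *)

(** The bound is [n - 3]. The cubic equals [- 2 * (k + 1) ^ 2] there and is positive at [n - 1], so
    it has a root in between, and [theta] is at least that root. *)
Lemma theta_ge (R : realType) (k r : nat) (theta : R) :
  is_theta (k + 4 + 2 * r) k theta -> k%:R + 1 + 2 * r%:R <= theta.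
Proof.
case=> _ theta_max.
have nR : (k + 4 + 2 * r)%:R = k%:R + 4 + 2 * r%:R :> R.
  by rewrite natrD natrM natrD.
have k_ge0 : 0 <= k%:R :> R by rewrite ler0n.
have r_ge0 : 0 <= r%:R :> R by rewrite ler0n.
set K : R := k%:R in nR k_ge0 *; set s : R := r%:R in nR r_ge0 *.
pose n : R := K + 4 + 2 * s.
pose p : {poly R} := 'X^3 - (n - 4) *: 'X^2 - (n + 2 * K - 1) *: 'X
  + (2 * (K + 1) * (n - K - 4))%:P.
have pE x : p.[x] = x ^+ 3 - (n - 4) * x ^+ 2 - (n + 2 * K - 1) * x
    + 2 * (K + 1) * (n - K - 4) by rewrite /p !hornerE.
have [||x /andP[xge _] /rootP px] := @poly_ivt R p (n - 3) (n - 1).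
- by lra.
- rewrite !pE; apply/andP; split; rewrite -subr_ge0.
    have -> : 0 - ((n - 3) ^+ 3 - (n - 4) * (n - 3) ^+ 2
        - (n + 2 * K - 1) * (n - 3) + 2 * (K + 1) * (n - K - 4))
      = 2 * (K + 1) ^+ 2 by rewrite /n; ring.
    by rewrite mulr_ge0 // sqr_ge0.
  have -> : (n - 1) ^+ 3 - (n - 4) * (n - 1) ^+ 2
      - (n + 2 * K - 1) * (n - 1) + 2 * (K + 1) * (n - K - 4) - 0
    = 2 * (2 * s + 1) * (2 * K + 2 * s + 5) + 2 * (K + 2 * s + 4) by rewrite /n; ring.
  by rewrite addr_ge0 // !mulr_ge0 //; lra.
have xr : theta_equation (k + 4 + 2 * r) k x.
  by rewrite /theta_equation nR -/K -/n -pE.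
by have := theta_max x xr; rewrite /n in xge; lra.
Qed.

(* Writing [K = k + 1] and [d = lam - K - 2r], the cubic equation reads
   [d lam (lam + 1) = 2 K (K + d)]; it makes [lam] times the quadratic equal to
   [r * q] for the simpler [q] below. *)
Lemma theta_independent_set (R : realFieldType) (k r lam : R) :
  0 <= k -> k + 1 + 2 * r <= lam ->
  [\/ r = 2 /\ k = 0, r = 3, r = 4 | 5 <= r] ->
  let n := k + 4 + 2 * r in
  lam ^+ 3 - (n - 4) * lam ^+ 2 - (n + 2 * k - 1) * lam
    + 2 * (k + 1) * (n - k - 4) = 0 ->
  0 <= lam ^+ 2 - (k + r) * lam - (k + 1 + r) * (r + 3).
Proof.
move=> k_ge0 lam_ge rP n; rewrite /n {n}.
have [d -> d_ge0] : exists2 d, lam = k + 1 + 2 * r + d & 0 <= d.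
  by exists (lam - (k + 1 + 2 * r)); [ring|rewrite subr_ge0].
move=> g0.
have {}g0 : d * (k + 1 + 2 * r + d) * (k + 1 + 2 * r + d + 1)
    - 2 * (k + 1) * (k + 1 + d) = 0 by rewrite -[RHS]g0; ring.
set H := (X in 0 <= X).
pose q := d ^+ 2 + d * (k + 1) + (r - 5) * (k + 1) + (3 * r - 1) * d
  + 2 * r * (r - 1).
have r_gt0 : 0 < r by case: rP => [[-> _]|->|->|]; lra.
have Hq : (k + 1 + 2 * r + d) * H = r * q.
  by apply/eqP; rewrite -subr_eq0 -g0 /H /q; apply/eqP; ring.
have L_gt0 : 0 < k + 1 + 2 * r + d by lra.
have [K KE K_ge1] : exists2 K, K = k + 1 & 1 <= K by exists (k + 1); lra.
rewrite -(pmulr_rge0 _ L_gt0) Hq pmulr_rge0 // /q {H q Hq} -KE in g0 *.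
have dK : 0 <= d * K by rewrite mulr_ge0 //; lra.
have dd : 0 <= d ^+ 2 by rewrite sqr_ge0.
case: rP => [[-> k0]|r3|r4|r5].
- by rewrite KE k0; lra.
- rewrite r3 in g0 *; rewrite leNgt; apply/negP => q_lt0.
  (* [b] is [- q]. The multiplier [d + 5] is chosen so that, modulo the cubic, [b * K + b * (d + 5)]
     equals [- 2 * K - 10 * d - 60], which is negative. *)
  pose b := K * (2 - d) - (d + 2) * (d + 6).
  have b_gt0 : 0 < b by rewrite /b; lra.
  have bK : 0 < b * K by rewrite mulr_gt0 //; lra.
  have bd : 0 <= b * (d + 5) by rewrite mulr_ge0 //; lra.
  rewrite /b in bK bd; lra.
- rewrite r4 in g0 *; rewrite leNgt; apply/negP => q_lt0.
  (* Again [b] is [- q]. Its positivity forces [d < 1] and [K > 24]; with these, the cubic and the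
     products below give [43 * K < 90]. *)
  pose b := K * (1 - d) - (d + 3) * (d + 8).
  have b_gt0 : 0 < b by rewrite /b; lra.
  have d_lt1 : d < 1.
    rewrite ltNge; apply/negP => d_ge1.
    have : 0 <= K * (d - 1) by rewrite mulr_ge0 //; lra.
    by rewrite /b in b_gt0; lra.
  have bK : 0 < b * K by rewrite mulr_gt0 //; lra.
  have K_gt24 : 24 < K by rewrite /b in b_gt0; lra.
  have KK : 0 <= (K - 24) * K by rewrite mulr_ge0 //; lra.
  have Kd : 0 <= K * ((1 - d) * (d + 5)) by rewrite !mulr_ge0 //; lra.
  have d3 : 0 <= (1 - d) * (d ^+ 2 + 18 * d + 90) by rewrite mulr_ge0 //; lra.
  by rewrite /b in bK; lra.
- have : 0 <= (r - 5) * K by rewrite mulr_ge0 //; lra.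
  have : 0 <= (3 * r - 1) * d by rewrite mulr_ge0 //; lra.
  have : 0 <= 2 * r * (r - 1) by rewrite !mulr_ge0 //; lra.
  by lra.
Qed.

Lemma monic_quadratic_root (R : rcfType) (b c x : R) :
  0 <= b ^+ 2 + 4 * c -> x = (b + Num.sqrt (b ^+ 2 + 4 * c)) / 2 ->
  x ^+ 2 - b * x - c = 0.
Proof.
move=> disc_ge0 ->; set s := Num.sqrt _.
have ss : s ^+ 2 = b ^+ 2 + 4 * c by rewrite sqr_sqrtr.
have -> : ((b + s) / 2) ^+ 2 - b * ((b + s) / 2) - c =
  (s ^+ 2 - (b ^+ 2 + 4 * c)) / 4 by field.
by rewrite ss subrr mul0r.
Qed.

Lemma le_sqrt (R : rcfType) (x y : R) :
  0 <= x -> x ^+ 2 <= y -> x <= Num.sqrt y.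
Proof. by move=> x_ge0 xy; rewrite -(ger0_norm x_ge0) -sqrtr_sqr ler_wsqrtr. Qed.

(** * The three cases of the bound *)

Theorem theorem3p1 (R : realType) (k n : nat) (T : finType) (e : rel T)
    (e_sym : symmetric e) (e_irr : irreflexive e)
    (e_conn : vertex_connected k.+1 e)
    (order_e : #|T| = n) (n_mod2 : n = k %[mod 2])
    (theta : R) (thetaP : is_theta n k theta)
    (rho : R) (rhoP : is_spectral_radius e rho) :
  [/\ ((k + 4 <= n)%N /\ n <> (k + 6)%N /\ n <> (k + 8)%N) \/
        (k = 0%N /\ n = 8%N) ->
      theta < rho -> factor_critical k e,
      n = (k + 6)%N ->
      (k%:R + 1 + Num.sqrt (k%:R ^+ 2 + 18 * k%:R + 33)) / 2 < rho ->
      factor_critical k e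
    & (1 <= k)%N -> n = (k + 8)%N ->
      (k%:R + 2 + Num.sqrt (k%:R ^+ 2 + 24 * k%:R + 64)) / 2 < rho ->
      factor_critical k e].
Proof.
have k_ge0 : 0 <= k%:R :> R by rewrite ler0n.
split.
- move=> nP theta_lt; pose r := ((n - k - 4) %/ 2)%N.
  have nE : n = (k + 4 + 2 * r)%N by rewrite /r; lia.
  have {}theta_ge : k%:R + 1 + 2 * r%:R <= theta.
    by apply: theta_ge; rewrite -nE.
  have nR : n%:R = k%:R + 4 + 2 * r%:R :> R by rewrite nE natrD natrM natrD.
  apply: (factor_critical_of_spectral_radius e_sym e_irr e_conn
    (etrans order_e nE) theta_ge _ _ rhoP theta_lt).
    by case: thetaP => eq0 _; rewrite order_e; rewrite /theta_equation in eq0; rewrite eq0.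
  move=> r_gt0; apply: theta_independent_set => //; last first.
    by case: thetaP => eq0 _; rewrite -nR; exact: eq0.
  (* Here [r = 1] is excluded, and [r = 2] occurs only with [k = 0]: these are the orders [k + 6]
     and [k + 8]. *)
  have [r5|r5] := leqP 5 r; first by apply: Or44; rewrite (ler_nat R 5 r).
  have : [\/ r = 2 /\ k = 0, r = 3 | r = 4]%N.
    have [r2|r2] := eqVneq r 2%N; first by apply: Or31; lia.
    have [r3|r3] := eqVneq r 3%N; first by apply: Or32.
    by apply: Or33; lia.
  by case=> [[-> ->]|->|->]; [apply: Or41|apply: Or42|apply: Or43].
- move=> nE rho_gt; set lam := (X in X < rho) in rho_gt.
  have nR : n%:R = k%:R + 6 :> R by rewrite nE natrD.
  have lam_eq : lam ^+ 2 - (k%:R + 1) * lam - 4 * (k%:R + 2) = 0.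
    have discE : k%:R ^+ 2 + 18 * k%:R + 33 =
        (k%:R + 1) ^+ 2 + 4 * (4 * (k%:R + 2)) :> R by ring.
    apply: monic_quadratic_root; rewrite -discE //.
    by rewrite !addr_ge0 // ?mulr_ge0 // sqr_ge0.
  have lam_ge : k%:R + 3 <= lam.
    have : k%:R + 5 <= Num.sqrt (k%:R ^+ 2 + 18 * k%:R + 33) :> R.
      by apply: le_sqrt; lra.
    by rewrite /lam; lra.
  apply: (@factor_critical_of_spectral_radius _ _ 1 _ e lam rho) => //.
  + by rewrite order_e nE -addnA.
  + by rewrite mulr1; lra.
  (* The cubic is divided by the quadratic that vanishes at [lam]; only the remainder
     [2 * (lam - 2)] has to be nonnegative. *)
  + rewrite order_e nR; set g := (X in 0 <= X).
    have -> : g = (lam - 1) * (lam ^+ 2 - (k%:R + 1) * lam - 4 * (k%:R + 2))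
      + 2 * (lam - 2) by rewrite /g; ring.
    by rewrite lam_eq mulr0 add0r; lra.
  + by move=> _; rewrite -lam_eq le_eqVlt; apply/orP; left; apply/eqP; ring.
- move=> k_ge1 nE rho_gt; set lam := (X in X < rho) in rho_gt.
  have kR_ge1 : 1 <= k%:R :> R by rewrite ler1n.
  have nR : n%:R = k%:R + 8 :> R by rewrite nE natrD.
  have lam_eq : lam ^+ 2 - (k%:R + 2) * lam - 5 * (k%:R + 3) = 0.
    have discE : k%:R ^+ 2 + 24 * k%:R + 64 =
        (k%:R + 2) ^+ 2 + 4 * (5 * (k%:R + 3)) :> R by ring.
    apply: monic_quadratic_root; rewrite -discE //.
    by rewrite !addr_ge0 // ?mulr_ge0 // sqr_ge0.
  have lam_ge : k%:R + 5 <= lam.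
    have : k%:R + 8 <= Num.sqrt (k%:R ^+ 2 + 24 * k%:R + 64) :> R.
      by apply: le_sqrt; lra.
    by rewrite /lam; lra.
  apply: (@factor_critical_of_spectral_radius _ _ 2 _ e lam rho) => //.
  + by rewrite order_e nE -addnA.
  + by lra.
  (* The remainder is at least [2 * k - 2] because [lam >= k + 5]; this is where [1 <= k] enters. *)
  + rewrite order_e nR; set g := (X in 0 <= X).
    have -> : g = (lam - 2) * (lam ^+ 2 - (k%:R + 2) * lam - 5 * (k%:R + 3))
      + (4 * lam - 2 * k%:R - 22) by rewrite /g; ring.
    by rewrite lam_eq mulr0 add0r; lra.
  + by move=> _; rewrite -lam_eq le_eqVlt; apply/orP; left; apply/eqP; ring.
Qed.
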